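(* Let $A=(A^{ij})_{i,j\in\mathbb{N}}$ be an infinite real matrix, and let $L(A)=(L(A)_{IJ})_{I,J\in\mathcal{D}}$ be the associated sequence indexed by dyadic rectangles. Then $A$ is bounded on $\ell^2_{\mathbb{N}}$ if and only if the operator $P_{L(A)}$ is bounded on $L^2(\mathbb{R}^2)$. In fact, $\|A\|_{2\to2}=\|P_{L(A)}\|_{2\to2}$.
   Context: Here $\mathbb{N}=\{0,1,2,\dots\}$, functions are real-valued, and $\mathcal{D}$ is the standard dyadic grid in $\mathbb{R}$, i.e. the collection of intervals $[k2^{-i},(k+1)2^{-i})$, $i,k\in\mathbb{Z}$. Letters $I,J$ always denote elements of $\mathcal{D}$. For $I\in\mathcal{D}$ let $h_I=|I|^{-1/2}(1_{I_l}-1_{I_r})$, where $I_l,I_r$ are the left and right halves of $I$. For an infinite matrix $A$, $\|A\|_{2\to2}\in[0,\infty]$ is its operator norm on $\ell^2_{\mathbb{N}}$, i.e. the supremum of $|\sum_{i,j}A^{ij}a_ib_j|$ over finitely supported real sequences $(a_i),(b_j)$ of $\ell^2$ norm $1$; $A$ is bounded if this is finite. The map $L$ is defined by $L(A)_{IJ}=2^{-(i+j)/2}A^{ij}$ if $I\times J\subset[0,1)^2$ and $(|I|,|J|)=(2^{-i},2^{-j})$, and $L(A)_{IJ}=0$ if $I\times J\not\subset[0,1)^2$. For a real sequence $\lambda=(\lambda_{IJ})_{I,J\in\mathcal{D}}$ define the (mixed bi-parameter paraproduct) bilinear form $$P_\lambda(f,g)=\sum_{I,J}\lambda_{IJ}\Big\langle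 f,h_I\otimes\frac{1_J}{|J|}\Big\rangle\Big\langle g,\frac{1_I}{|I|}\otimes h_J\Big\rangle$$ for $f\in\mathcal{A}$, $g\in\mathcal{B}$, where $\mathcal{A}$ (resp. $\mathcal{B}$) is the set of $f=\sum_{I,J}f_{IJ}h_I\otimes h_J\in L^2(\mathbb{R}^2)$ with $\|f\|_2=1$ such that $f_{IJ}\neq0$ for only finitely many $I$ (resp. only finitely many $J$); the sum defining $P_\lambda(f,g)$ is then finite. Set $\|P_\lambda\|_{2\to2}=\sup_{f\in\mathcal{A},\,g\in\mathcal{B}}|P_\lambda(f,g)|\in[0,\infty]$; $P_\lambda$ is bounded on $L^2(\mathbb{R}^2)$ if this is finite. *)

(* Defs.v *)
From mathcomp Require Import all_boot all_order all_algebra.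
From mathcomp Require Import finmap.
From mathcomp Require Import all_classical all_reals all_analysis.
From mathcomp.analysis Require Import showcase.summability.
Import Order.TTheory GRing.Theory Num.Theory.
Import numFieldNormedType.Exports.

Set Implicit Arguments.
Unset Strict Implicit.
Unset Printing Implicit Defensive.

Local Open Scope classical_set_scope.
Local Open Scope ring_scope.

(* (i, k) stands for the interval [k 2^-i, (k+1) 2^-i); distinct pairs give
   distinct intervals. *)
Definition dyadic : Type := (int * int)%type.

Definition scale (I : dyadic) : int := I.1.

Definition left_half (I : dyadic) : dyadic := (I.1 + 1, I.2 *+ 2).
Definition right_half (I : dyadic) : dyadic := (I.1 + 1, I.2 *+ 2 + 1).

Notation lebesgue2 R := (@lebesgue_measure R \x @lebesgue_measure R)%E.

Section Dyadic.
Context {R : realType}.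

Definition len (I : dyadic) : R := 2 ^ (- scale I).

Definition interval_of (I : dyadic) : set R :=
  `[I.2%:~R * len I, (I.2 + 1)%:~R * len I[.

Definition haar (I : dyadic) : R -> R := fun x =>
  (len I) `^ (- 2^-1)
  * (\1_(interval_of (left_half I)) x - \1_(interval_of (right_half I)) x).

Definition avg (I : dyadic) : R -> R := fun x => \1_(interval_of I) x / len I.

Definition tensor (u v : R -> R) : R * R -> R := fun z => u z.1 * v z.2.

Definition inner (f g : R * R -> R) : R := \int[lebesgue2 R]_z (f z * g z).

Definition L2norm (f : R * R -> R) : \bar R :=
  'N[lebesgue2 R]_2%:E[EFin \o f].

(* f = \sum_(I, J) c I J h_I (x) h_J, with unconditional convergence in L^2. *)
Definition haar_sum (c : dyadic -> dyadic -> R) (f : R * R -> R) : Prop :=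
  (fun S : {fset dyadic * dyadic} => L2norm (fun z => f z
    - \sum_(p <- S) c p.1 p.2 * tensor (haar p.1) (haar p.2) z))
    @ totally --> 0%E.

(* Members are representatives of classes modulo a.e. equality. *)
Definition testA : set (R * R -> R) := [set f |
  [/\ f \in Lfun (lebesgue2 R) 2%:E, L2norm f = 1%E &
    exists2 c, haar_sum c f & finite_set [set I | exists J, c I J != 0]]].

Definition testB : set (R * R -> R) := [set g |
  [/\ g \in Lfun (lebesgue2 R) 2%:E, L2norm g = 1%E &
    exists2 c, haar_sum c g & finite_set [set J | exists I, c I J != 0]]].

(* For f in testA and g in testB only finitely many terms are nonzero; an
   infinitely supported sum would be 0 by convention. *)
Definition paraproduct (lam : dyadic -> dyadic -> R) (f g : R * R -> R) : R :=
  \sum_(p \in [set: dyadic * dyadic])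
    lam p.1 p.2 * inner f (tensor (haar p.1) (avg p.2))
                * inner g (tensor (avg p.1) (haar p.2)).

Definition paraproduct_norm (lam : dyadic -> dyadic -> R) : \bar R :=
  ereal_sup [set `|paraproduct lam fg.1 fg.2|%:E | fg in testA `*` testB].

Definition paraproduct_bounded (lam : dyadic -> dyadic -> R) : Prop :=
  (paraproduct_norm lam < +oo)%E.

Definition unit_finite_seq : set (nat -> R) := [set a |
  finite_set [set i | a i != 0] /\
  Num.sqrt (\sum_(i \in [set: nat]) a i ^+ 2) = 1].

Definition matrix_form (A : nat -> nat -> R) (a b : nat -> R) : R :=
  \sum_(p \in [set: nat * nat]) A p.1 p.2 * a p.1 * b p.2.

Definition matrix_norm (A : nat -> nat -> R) : \bar R :=
  ereal_sup [set `|matrix_form A ab.1 ab.2|%:E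
            | ab in unit_finite_seq `*` unit_finite_seq].

Definition matrix_bounded (A : nat -> nat -> R) : Prop :=
  (matrix_norm A < +oo)%E.

(* A rectangle inside the unit square has nonnegative scales, so taking the
   absolute value below only converts them to nat. *)
Definition Lseq (A : nat -> nat -> R) (I J : dyadic) : R :=
  if `[< interval_of I `*` interval_of J `<=` `[0, 1[ `*` `[0, 1[ >] then
    2 `^ (- (scale I + scale J)%:~R / 2) * A `|scale I|%N `|scale J|%N
  else 0.

End Dyadic.

(* Main.v *)
Require Import Defs.
From mathcomp Require Import all_boot all_order all_algebra.
From mathcomp Require Import finmap.
From mathcomp Require Import all_classical all_reals all_analysis.
From mathcomp.analysis Require Import measurable_realfun showcase.summability.
From mathcomp Require Import zify ring lra.

Import Order.TTheory GRing.Theory Num.Theory.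
Import numFieldNormedType.Exports.

Set Implicit Arguments.
Unset Strict Implicit.
Unset Printing Implicit Defensive.

Local Open Scope classical_set_scope.
Local Open Scope ring_scope.

(** Write [i] for the scale of [I] and [j] for that of [J], so that
    [|I| = 2^-i] and [|J| = 2^-j], and let [I_i(x)] be the interval of scale
    [i] that contains [x].

    Upper bound. Let [F_I(y) = <f(., y), h_I>] and [G_J(x) = <g(x, .), h_J>].
    With the coefficients of [Lseq A] the paraproduct is
      [int int_([0,1)^2) sum_(i,j) A^ij (2^(i/2) F_(I_i(x))(y))
                                        (2^(j/2) G_(J_j(y))(x)) dx dy],
    that is, the bilinear form of [A] is evaluated at every point [(x, y)] on
    a pair of vectors [a(x, y)], [b(x, y)]. It is therefore at most the norm of
    [A] times [int int (|a|^2 + |b|^2) / 2]. Since each [I] has measure [2^-i],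
    [int int |a|^2 = sum_I |F_I|_2^2 <= |f|_2^2], and likewise for [b].

    The partial integrals are avoided by averaging over the cells of a grid
    finer than every interval in the sum. A finitely supported sum only involves
    scales below some [n]; the points [x], [y] become cells [k'], [k] of scale
    [n] in [[0,1)], and [F_I(y)] becomes [<f, h_I (x) 1_K / |K|>] with [K] the
    cell [k]. Everything is then a finite sum ([sum_fibres], [sum_blocks],
    [matrix_norm_bound]), and the bound on [|a|^2] is Bessel's inequality for
    the orthonormal system [h_I (x) 1_K / |K|^(1/2)] ([block_energy],
    [paraproduct_le]).

    Lower bound. The vectors [a(x, y)] and [b(x, y)] are constant on the unit
    square for [f = r_a (x) 1_[0,1)] and [g = 1_[0,1) (x) r_b], where
    [r_a = sum_i a_i sum_(I in [0,1), |I| = 2^-i) |I|^(1/2) h_I] is a sum of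
    Rademacher functions; the paraproduct is then exactly [sum A^ij a_i b_j]
    ([paraproduct_rademacher]). These are admissible test functions because
    [1_[0,1)] is the sum of its Haar series over the intervals [[0, 2^k)],
    [k >= 1]. Convergence is read off from the exact residual
    [|f - sum_S <f, e> e|^2 = |f|^2 - sum_S <f, e>^2] ([dot_residual],
    [haar_sum_parseval]). *)

(** * Real L2 inner products and Bessel's inequality *)

Section InnerProduct.
Context {d : measure_display} {T : measurableType d} {R : realType}.
Variable mu : {measure set T -> \bar R}.
Implicit Types (f g : T -> R) (I J : eqType).

Definition dot f g : R := \int[mu]_x (f x * g x).

Local Notation L2 := (Lfun mu 2%:E).

Lemma L2_measurable f : f \in L2 -> measurable_fun setT f.
Proof. by rewrite inE => /andP[]; rewrite inE. Qed.

Lemma Lnorm2E f : f \in L2 ->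
  'N[mu]_2%:E[EFin \o f]%E = (Num.sqrt (dot f f))%:E.
Proof.
move=> f2; have i2 := Lfun2_integrable_sqr f2.
rewrite unlock; under eq_integral => x _ do
  rewrite /= powR_mulrn// real_normK ?num_real//.
rewrite -powR12_sqrt; last first.
  by apply: Rintegral_ge0 => x _; rewrite -expr2 sqr_ge0.
rewrite -poweR_EFin /dot /Rintegral fineK//.
exact: integrable_fin_num.
Qed.

Lemma L2P f : measurable_fun setT f ->
  mu.-integrable setT (EFin \o (fun x => f x ^+ 2)) -> f \in L2.
Proof.
move=> mf if2; rewrite inE; apply/andP; split; rewrite inE//=.
rewrite /finite_norm unlock poweR_lty//.
under eq_integral => x _ do
  rewrite /= powR_mulrn// real_normK ?num_real//.
exact: integrable_lty.
Qed.

Lemma integrable_mul f g : f \in L2 -> g \in L2 ->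
  mu.-integrable setT (EFin \o (fun x => f x * g x)).
Proof. by move=> f2 g2; exact/Lfun1_integrable/Lfun2_mul_Lfun1. Qed.

Lemma L2D f g : f \in L2 -> g \in L2 -> (fun x => f x + g x) \in L2.
Proof.
have p1 : (1 <= 2%:E :> \bar R)%E by rewrite lee_fin ler1n.
by case: (Lfun_addr_closed mu p1) => _; apply.
Qed.

Lemma L2Z c f : f \in L2 -> (fun x => c * f x) \in L2.
Proof.
move=> f2; under eq_fun do rewrite mulrC.
exact: (Lfun_scale c (ler1n R 2) f2).
Qed.

Lemma L20 : (fun _ : T => 0 : R) \in L2.
Proof.
have p1 : (1 <= 2%:E :> \bar R)%E by rewrite lee_fin ler1n.
by case: (Lfun_addr_closed mu p1).
Qed.

Lemma L2_sum I (s : seq I) (h : I -> T -> R) :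
  (forall i, h i \in L2) -> (fun x => \sum_(i <- s) h i x) \in L2.
Proof.
move=> h2; elim: s => [|i s IHs].
  by under eq_fun do rewrite big_nil; exact: L20.
by under eq_fun do rewrite big_cons; exact: L2D.
Qed.

Lemma dotC f g : dot f g = dot g f.
Proof. by apply: eq_Rintegral => x _; rewrite mulrC. Qed.

Lemma dot_ge0 f : 0 <= dot f f.
Proof. by apply: Rintegral_ge0 => x _; rewrite -expr2 sqr_ge0. Qed.

Lemma dotDl f g h : f \in L2 -> g \in L2 -> h \in L2 ->
  dot (fun x => f x + g x) h = dot f h + dot g h.
Proof.
move=> f2 g2 h2; rewrite /dot -RintegralD//; [|exact: integrable_mul..].
by apply: eq_Rintegral => x _; rewrite mulrDl.
Qed.

Lemma dotZl c f g : f \in L2 -> g \in L2 ->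
  dot (fun x => c * f x) g = c * dot f g.
Proof.
move=> f2 g2; rewrite /dot -RintegralZl//; last exact: integrable_mul.
by apply: eq_Rintegral => x _; rewrite mulrA.
Qed.

Lemma dotZr c f g : f \in L2 -> g \in L2 ->
  dot f (fun x => c * g x) = c * dot f g.
Proof. by move=> f2 g2; rewrite dotC dotZl// dotC. Qed.

Lemma dot0l g : dot (fun=> 0) g = 0.
Proof.
rewrite /dot; under eq_Rintegral do rewrite mul0r.
by rewrite Rintegral_cst// mul0r.
Qed.

Lemma dot_suml I (s : seq I) (h : I -> T -> R) g :
  (forall i, h i \in L2) -> g \in L2 ->
  dot (fun x => \sum_(i <- s) h i x) g = \sum_(i <- s) dot (h i) g.
Proof.
move=> h2 g2; elim: s => [|i s IHs].
  by under eq_fun do rewrite big_nil; rewrite big_nil dot0l.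
under eq_fun do rewrite big_cons.
by rewrite dotDl ?big_cons ?IHs//; exact: L2_sum.
Qed.

Lemma dot_sumr I (s : seq I) (h : I -> T -> R) g :
  (forall i, h i \in L2) -> g \in L2 ->
  dot g (fun x => \sum_(i <- s) h i x) = \sum_(i <- s) dot g (h i).
Proof.
by move=> h2 g2; rewrite dotC dot_suml//; apply: eq_bigr => i _; rewrite dotC.
Qed.

Lemma dot_lincomb I (s : seq I) (c : I -> R) (h : I -> T -> R) g :
  (forall i, h i \in L2) -> g \in L2 ->
  dot g (fun x => \sum_(i <- s) c i * h i x) = \sum_(i <- s) c i * dot g (h i).
Proof.
move=> h2 g2; rewrite dot_sumr// => [|i]; last exact: L2Z.
by apply: eq_bigr => i _; rewrite dotZr.
Qed.

Definition orthonormal_system I (e : I -> T -> R) :=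
  (forall i, e i \in L2) /\ (forall i j, dot (e i) (e j) = (i == j)%:R).

Lemma orthonormal_reindex I J (phi : J -> I) (e : I -> T -> R) :
  injective phi -> orthonormal_system e -> orthonormal_system (e \o phi).
Proof.
by move=> inj [e2 eE]; split=> [j|j j'] /=; rewrite ?eE ?inj_eq//.
Qed.

Lemma dot_orthonormal_sum I (e : I -> T -> R) (c : I -> R) (s : seq I) j :
  orthonormal_system e -> uniq s ->
  dot (fun x => \sum_(i <- s) c i * e i x) (e j) = if j \in s then c j else 0.
Proof.
move=> [e2 eij] us; rewrite dot_suml => [|i|]; [|exact: L2Z|exact: e2].
under eq_bigr do rewrite dotZl// eij.
case: ifPn => js.
  rewrite (bigD1_seq j)//= eqxx mulr1 big1 ?addr0// => i /negPf ->.
  by rewrite mulr0.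
rewrite big_seq big1// => i is_; case: eqP => [ij|]; last by rewrite mulr0.
by rewrite -ij is_ in js.
Qed.

Lemma L2_orthonormal_sum I (e : I -> T -> R) (c : I -> R) (s : seq I) :
  orthonormal_system e -> (fun x => \sum_(i <- s) c i * e i x) \in L2.
Proof. by case=> e2 _; apply: L2_sum => i; exact: L2Z. Qed.

Lemma dot_orthonormal_sum_self I (e : I -> T -> R) (c : I -> R) (s : seq I) :
  orthonormal_system e -> uniq s ->
  dot (fun x => \sum_(i <- s) c i * e i x) (fun x => \sum_(i <- s) c i * e i x)
    = \sum_(i <- s) c i ^+ 2.
Proof.
move=> oe us; have e2 := oe.1; rewrite dot_sumr => [|i|]; last 2 first.
- exact/L2Z/e2.
- exact: L2_orthonormal_sum.
rewrite [LHS]big_seq [RHS]big_seq; apply: eq_bigr => j js.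
rewrite dotZr//; last exact: L2_orthonormal_sum.
by rewrite dot_orthonormal_sum// js.
Qed.

(** Pythagoras: subtracting the projection onto the span of the [e i] removes
    exactly the energy of the coefficients. This gives Bessel's inequality, and
    later reduces the convergence of a Haar series to that of a numerical
    series. *)
Lemma dot_residual I (e : I -> T -> R) (s : seq I) f :
  orthonormal_system e -> uniq s -> f \in L2 ->
  let h := fun x => f x - \sum_(i <- s) dot f (e i) * e i x in
  h \in L2 /\ dot h h = dot f f - \sum_(i <- s) dot f (e i) ^+ 2.
Proof.
move=> oe us f2 /=.
set p := fun x => \sum_(i <- s) dot f (e i) * e i x.
have p2 : p \in L2 by exact: L2_orthonormal_sum.
have -> : (fun x => f x - \sum_(i <- s) dot f (e i) * e i x) =
          (fun x => f x + -1 * p x) by apply/funext => x; rewrite mulN1r.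
have Np2 : (fun x => -1 * p x) \in L2 by exact: L2Z.
have h2 : (fun x => f x + -1 * p x) \in L2 by exact: L2D.
split=> //; set q := fun x => -1 * p x.
rewrite (dotDl f2 Np2 h2) (dotC f) (dotC q).
rewrite (dotDl f2 Np2 f2) (dotDl f2 Np2 Np2).
rewrite (dotZl _ p2 f2) (dotZl _ p2 Np2) (dotZr _ f2 p2) (dotZr _ p2 p2).
rewrite (dotC p f) [dot p p]dot_orthonormal_sum_self//.
have -> : dot f p = \sum_(i <- s) dot f (e i) ^+ 2.
  rewrite /p dot_sumr => [|i|//]; last exact/L2Z/oe.1.
  by apply: eq_bigr => i _; rewrite dotZr// ?expr2//; exact: oe.1.
ring.
Qed.

Lemma bessel I (e : I -> T -> R) (s : seq I) f :
  orthonormal_system e -> uniq s -> f \in L2 ->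
  \sum_(i <- s) dot f (e i) ^+ 2 <= dot f f.
Proof.
move=> oe us f2; have [_ hh] := dot_residual oe us f2.
by rewrite -subr_ge0 -hh dot_ge0.
Qed.

End InnerProduct.

(** * Tensor products *)

Section ProductIntegral.
Context {d1 d2 : measure_display} {T1 : measurableType d1}
  {T2 : measurableType d2} {R : realType}.
Variables (m1 : {sigma_finite_measure set T1 -> \bar R})
          (m2 : {sigma_finite_measure set T2 -> \bar R}).

Lemma measurable_fun_prod (u : T1 -> R) (v : T2 -> R) :
  measurable_fun setT u -> measurable_fun setT v ->
  measurable_fun setT (fun z : T1 * T2 => u z.1 * v z.2).
Proof.
move=> mu mv; apply: measurable_funM.
  exact: (measurableT_comp mu).
exact: (measurableT_comp mv).
Qed.

Lemma Rintegral_prod (u : T1 -> R) (v : T2 -> R) :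
  m1.-integrable setT (EFin \o u) -> m2.-integrable setT (EFin \o v) ->
  (m1 \x m2)%E.-integrable setT (EFin \o (fun z => u z.1 * v z.2)) /\
  \int[(m1 \x m2)%E]_z (u z.1 * v z.2) =
    (\int[m1]_x u x) * (\int[m2]_y v y).
Proof.
move=> iu iv.
have mu : measurable_fun setT u by exact/measurable_EFinP/(measurable_int _ iu).
have mv : measurable_fun setT v by exact/measurable_EFinP/(measurable_int _ iv).
pose w (z : T1 * T2) := u z.1 * v z.2.
have mw : measurable_fun setT (EFin \o w).
  by apply/measurable_EFinP; exact: measurable_fun_prod.
have fu : (\int[m1]_x `|(u x)%:E|)%E \is a fin_num.
  exact: (integrable_fin_num measurableT (integrable_abse iu)).
have fv : (\int[m2]_x `|(v x)%:E|)%E \is a fin_num.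
  exact: (integrable_fin_num measurableT (integrable_abse iv)).
have iw : (m1 \x m2)%E.-integrable setT (EFin \o w).
  apply: (proj2 (@integrable12ltyP _ _ _ _ R m1 m2 (EFin \o w) mw)).
  have E x : (\int[m2]_y `|(EFin \o w) (x, y)| =
              `|(u x)%:E| * \int[m2]_y `|(v y)%:E|)%E.
    rewrite -ge0_integralZl//; last first.
      by apply/measurable_EFinP; exact: measurableT_comp.
    by apply: eq_integral => y _; rewrite /w /= normrM EFinM.
  under eq_integral do rewrite E.
  rewrite -(fineK fv) ge0_integralZr//.
  - by rewrite -(fineK fu) -EFinM ltry.
  - by apply/measurable_EFinP; exact: measurableT_comp.
  - by rewrite fineK// integral_ge0.
split => //; rewrite /Rintegral -(integral12_prod_meas1 iw).
have E x : (\int[m2]_y (EFin \o w) (x, y) = (u x)%:E * \int[m2]_y (v y)%:E)%E.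
  by rewrite -integralZl//.
transitivity (fine (\int[m1]_x ((u x)%:E * \int[m2]_y (v y)%:E))%E).
  by congr fine; apply: eq_integral => x _; exact: E.
have fv' : (\int[m2]_y (v y)%:E)%E \is a fin_num by exact: integrable_fin_num.
rewrite -(fineK fv') integralZr// fineM//.
exact: integrable_fin_num.
Qed.

End ProductIntegral.

Section Tensor.
Context {R : realType}.
Implicit Types (u v : R -> R).

Local Notation leb := (@lebesgue_measure R).
Local Notation L2 := (Lfun leb 2%:E).

Lemma dot_tensor u v u' v' : u \in L2 -> v \in L2 -> u' \in L2 -> v' \in L2 ->
  inner (tensor u v) (tensor u' v') = dot leb u u' * dot leb v v'.
Proof.
move=> u2 v2 u'2 v'2; rewrite /dot.
have [_ <-] := Rintegral_prod (integrable_mul u2 u'2) (integrable_mul v2 v'2).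
by apply: eq_Rintegral => z _; rewrite /tensor mulrACA.
Qed.

Lemma L2_tensor u v : u \in L2 -> v \in L2 ->
  tensor u v \in Lfun (lebesgue2 R) 2%:E.
Proof.
move=> u2 v2; apply: L2P.
  exact: (measurable_fun_prod (L2_measurable u2) (L2_measurable v2)).
have [it _] := Rintegral_prod (integrable_mul u2 u2) (integrable_mul v2 v2).
by under eq_fun do rewrite /= /tensor expr2 mulrACA.
Qed.

Lemma orthonormal_tensor (I J : eqType) (e : I -> R -> R) (e' : J -> R -> R) :
  orthonormal_system leb e -> orthonormal_system leb e' ->
  orthonormal_system (lebesgue2 R) (fun p : I * J => tensor (e p.1) (e' p.2)).
Proof.
move=> [e2 eE] [e'2 e'E]; split=> [p|p q]; first exact: L2_tensor.
rewrite -[dot _ _ _]/(inner _ _) dot_tensor// eE e'E -natrM mulnb.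
by case: p q => [i j] [i' j'].
Qed.

End Tensor.

(** * Dyadic intervals and Haar functions on the line *)

Section DyadicLine.
Context {R : realType}.
Implicit Types (I J : dyadic) (x : R).

Local Notation leb := (@lebesgue_measure R).
Local Notation L2 := (Lfun leb 2%:E).

Lemma len_gt0 I : 0 < len I :> R.
Proof. by rewrite exprz_gt0. Qed.

(** The position of the interval of scale [i] that contains [x]. Indicators of
    dyadic intervals, and hence Haar functions, become equations between
    integers, and nestedness becomes integer division. *)
Definition cell (i : int) (x : R) : int := Num.floor (x * 2 ^ i).

(** An integer [k] satisfies [k <= x * 2^i] iff [k * 2^n <= x * 2^(i+n)], and
    the floor sees only integers; this is the nestedness of dyadic intervals. *)
Lemma cell_coarsen i n x : cell i x = (cell (i + n%:Z) x %/ 2 ^+ n)%Z.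
Proof.
have n0 : 0 < 2 ^+ n :> int by rewrite exprn_gt0.
apply: floor_def; rewrite -floor_ge_int -floor_lt_int.
have E : x * 2 ^ (i + n%:Z) = (x * 2 ^ i) * (2 ^+ n)%:~R :> R.
  by rewrite expfzDr// mulrA rmorphXn.
have le_cell k : (k <= Num.floor (x * 2 ^ i)) =
    (k * 2 ^+ n <= cell (i + n%:Z) x).
  by rewrite /cell E !floor_ge_int rmorphM/= ler_pM2r// ltr0z.
rewrite ltNge !le_cell -!lez_divRL// lexx/= -ltNge.
by rewrite ltzD1.
Qed.

Lemma indic_interval I x :
  \1_(interval_of I) x = (cell I.1 x == I.2)%:R :> R.
Proof.
rewrite indicE /interval_of /cell floor_eq; congr (_%:R); congr nat_of_bool.
rewrite (@mem_setE _ _) in_itv/=.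
have -> : len I = (2 ^ I.1)^-1 :> R by rewrite /len -invr_expz.
by rewrite ler_pdivrMr ?exprz_gt0// ltr_pdivlMr ?exprz_gt0.
Qed.

Lemma cell_left_end I : cell I.1 (I.2%:~R * len I) = I.2.
Proof.
by rewrite /cell /len -mulrA -expfzDr// addNr expr0z mulr1 intrKfloor.
Qed.

Lemma sqr_sqrt_len I : Num.sqrt (len I) ^+ 2 = len I :> R.
Proof. by rewrite sqr_sqrtr// ltW// len_gt0. Qed.

Lemma haarE I x : haar I x = (Num.sqrt (len I))^-1 *
  ((cell (I.1 + 1) x == I.2 *+ 2)%:R - (cell (I.1 + 1) x == I.2 *+ 2 + 1)%:R).
Proof.
by rewrite /haar powRN powR12_sqrt ?(ltW (len_gt0 _))// !indic_interval.
Qed.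

Lemma cell_halves I x : (cell I.1 x == I.2) =
  (cell (I.1 + 1) x == I.2 *+ 2) || (cell (I.1 + 1) x == I.2 *+ 2 + 1).
Proof. by rewrite (cell_coarsen I.1 1) expr1; move: (cell _ _) => c; lia. Qed.

Lemma haar_out I x : cell I.1 x != I.2 -> haar I x = 0.
Proof.
rewrite cell_halves negb_or haarE => /andP[/negPf -> /negPf ->].
by rewrite subrr mulr0.
Qed.

Lemma haar_sqr I x : haar I x * haar I x = (len I)^-1 * \1_(interval_of I) x.
Proof.
rewrite haarE indic_interval cell_halves -[in RHS]sqr_sqrt_len -exprVn.
move: (Num.sqrt _)^-1 => s; case: (eqVneq _ (I.2 *+ 2)) => [->|_] /=.
  have /negPf -> : I.2 *+ 2 != I.2 *+ 2 + 1 by lia.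
  by rewrite /=; ring.
by case: eqVneq => _ /=; ring.
Qed.

Lemma measurable_interval I : measurable (interval_of I : set R).
Proof. exact: measurable_itv. Qed.

Lemma integrable_interval I :
  leb.-integrable setT (EFin \o \1_(interval_of I)).
Proof. exact: integrable_indic_itv. Qed.

Lemma Rintegral_interval I : \int[leb]_x \1_(interval_of I) x = len I.
Proof.
rewrite /Rintegral integral_indic//; last exact: measurable_interval.
rewrite setIT /interval_of.
have /= -> := lebesgue_measure_itv
  `[I.2%:~R * len I : R, (I.2 + 1)%:~R * len I[.
rewrite lte_fin intrD1.
by rewrite ltr_pM2r ?len_gt0// ltrDl ltr01/= mulrDl mul1r addrAC subrr add0r.
Qed.

Lemma interval_L2 I : \1_(interval_of I) \in L2.
Proof.
apply: L2P.
  by apply: measurable_indic; exact: measurable_interval.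
have := integrable_interval I; congr (leb.-integrable _ _).
by apply/funext => x; rewrite /= indicE -natrX; case: (_ \in _).
Qed.

Lemma haar_L2 I : haar I \in L2.
Proof.
have := L2Z ((len I) `^ (- 2^-1)) (L2D (interval_L2 (left_half I))
  (L2Z (-1) (interval_L2 (right_half I)))).
by under eq_fun do rewrite mulN1r.
Qed.

Lemma avg_L2 I : avg I \in L2.
Proof.
have := L2Z (len I)^-1 (interval_L2 I).
by under eq_fun do rewrite mulrC.
Qed.

Lemma haar_mean0 I : leb.-integrable setT (EFin \o haar I) /\
  \int[leb]_x haar I x = 0.
Proof.
pose D x : R :=
  \1_(interval_of (left_half I)) x - \1_(interval_of (right_half I)) x.
have iD : leb.-integrable setT (EFin \o D).
  have := integrableB measurableT (integrable_interval (left_half I))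
    (integrable_interval (right_half I)).
  by congr (leb.-integrable _ _).
split.
  exact: (integrableZl measurableT ((len I) `^ (- 2^-1)) iD).
rewrite /haar RintegralZl// RintegralB//; try exact: integrable_interval.
by rewrite !Rintegral_interval /len /= subrr mulr0.
Qed.

(** The halves of [I] have scale [I.1 + 1 <= J.1], so [haar I] is constant on
    [J]; its value there is read at the left endpoint of [J]. *)
Lemma haar_coarse I J x : I.1 < J.1 ->
  haar I x * haar J x = haar I (J.2%:~R * len J) * haar J x.
Proof.
move=> IJ; have [xJ|/haar_out ->] := eqVneq (cell J.1 x) J.2; last first.
  by rewrite !mulr0.
have [n nE] : exists n : nat, J.1 = I.1 + 1 + n%:Z.
  by exists (absz (J.1 - I.1 - 1)%R); lia.
congr (_ * _); rewrite !haarE !(cell_coarsen (I.1 + 1) n) -nE xJ.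
by rewrite cell_left_end.
Qed.

Lemma dot_haar_coarse I J : I.1 < J.1 -> dot leb (haar I) (haar J) = 0.
Proof.
move=> IJ; rewrite /dot.
under eq_Rintegral do rewrite haar_coarse//.
have [iJ J0] := haar_mean0 J.
by rewrite RintegralZl// J0 mulr0.
Qed.

(** At different scales the coarser function is constant on the support of the
    finer one, which has mean zero; at equal scales the supports are disjoint. *)
Lemma haar_orthonormal : orthonormal_system leb haar.
Proof.
split=> [I|I J]; first exact: haar_L2.
case: (ltgtP I.1 J.1) => [IJ|JI|E].
- by rewrite dot_haar_coarse//; case: eqP IJ => // ->; rewrite ltxx.
- by rewrite dotC dot_haar_coarse//; case: eqP JI => // ->; rewrite ltxx.
have [->|nIJ] := eqVneq I J.
  rewrite /dot; under eq_Rintegral do rewrite haar_sqr.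
  rewrite RintegralZl//; last exact: integrable_interval.
  by rewrite Rintegral_interval mulVf// gt_eqF// len_gt0.
transitivity (dot leb (fun=> 0) (haar J)); last exact: dot0l.
apply: eq_Rintegral => x _; rewrite mul0r.
have [xI|/haar_out ->] := eqVneq (cell I.1 x) I.2; last by rewrite mul0r.
rewrite (@haar_out J) ?mulr0// -E xI; apply: contraNneq nIJ => E2.
by rewrite [I]surjective_pairing [J]surjective_pairing E E2.
Qed.

Lemma dot_interval I J : I.1 = J.1 ->
  dot leb (\1_(interval_of I)) (\1_(interval_of J)) = (I == J)%:R * len I.
Proof.
move=> E; rewrite -Rintegral_interval -RintegralZl//; last first.
  exact: integrable_interval.
apply: eq_Rintegral => x _.
rewrite !indic_interval -E -pair_eqE /pair_eq /= E eqxx /=.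
by case: eqVneq => [->|_]; rewrite ?mul1r ?mulr1 ?mul0r ?mulr0//=.
Qed.

End DyadicLine.

(** * Rectangles inside the unit square *)

Section FiniteSums.
Context {R : realType}.

Lemma big_iota_ord (n : nat) (F : nat -> R) :
  \sum_(i <- iota 0 n) F i = \sum_(i < n) F i.
Proof. by rewrite -[n in iota 0 n]subn0 big_mkord. Qed.

Lemma fsum_square (T : choiceType) (s : seq T) (F : T * T -> R) : uniq s ->
  (forall p, F p != 0 -> (p.1 \in s) && (p.2 \in s)) ->
  \sum_(p \in [set: T * T]) F p = \sum_(x <- s) \sum_(y <- s) F (x, y).
Proof.
move=> us Fs; rewrite (fsbigE [seq (x, y) | x <- s, y <- s]) //.
- by under eq_bigl do rewrite in_setT; rewrite big_allpairs_dep.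
- by apply: allpairs_uniq => // -[? ?] [? ?] _ _ [-> ->].
- move=> [x y] _ xys; apply: contraNeq xys => /Fs /= /andP[xs ys].
  by apply/allpairsP; exists (x, y).
Qed.

End FiniteSums.

Section UnitDyadic.
Implicit Types (I J : dyadic).

(** The dyadic subintervals of [[0, 1)] with scale less than [n]. *)
Definition unit_dyadics (n : nat) : seq dyadic :=
  [seq (i%:Z, l%:Z) | i <- iota 0 n, l <- iota 0 (2 ^ i)%N].

Lemma PoszX2 i : (2 ^ i)%N%:Z = 2 ^+ i :> int.
Proof. by rewrite -natz natrX. Qed.

Lemma mem_unit_dyadics n I : (I \in unit_dyadics n) =
  [&& 0 <= I.1, I.1 < n%:Z, 0 <= I.2 & I.2 < 2 ^+ `|I.1|].
Proof.
case: I => i k /=; apply/allpairsPdep/idP => [[i' [l [+ + [-> ->]]]]|].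
  rewrite !mem_iota /= !add0n => i'n ln.
  by rewrite /= -PoszX2 !ltz_nat i'n.
case: i => // i; case: k => [l|k]; last by rewrite !andbF.
rewrite /= -PoszX2 !ltz_nat => /andP[ni li].
by exists i, l; rewrite !mem_iota.
Qed.

Lemma uniq_unit_dyadics n : uniq (unit_dyadics n).
Proof.
apply: allpairs_uniq_dep; first exact: iota_uniq.
- by move=> i _; exact: iota_uniq.
- by move=> [i l] [i' l'] _ _ /= [-> ->].
Qed.

Lemma big_unit_dyadics (R : realType) n (F : dyadic -> R) :
  \sum_(I <- unit_dyadics n) F I =
  \sum_(i < n) \sum_(l < (2 ^ i)%N) F (i%:Z, l%:Z).
Proof.
rewrite /unit_dyadics big_allpairs_dep big_iota_ord.
by apply: eq_bigr => i _; rewrite big_iota_ord.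
Qed.

Context {R : realType}.

Lemma unit_dyadics_subset n I : I \in unit_dyadics n ->
  interval_of I `<=` (`[0, 1[ : set R).
Proof.
rewrite mem_unit_dyadics => /and4P[i0 _ k0 kl] x.
rewrite /interval_of /= !in_itv /= => /andP[lx xr].
rewrite (le_trans _ lx)/=; last by rewrite mulr_ge0 ?ler0z// ltW// len_gt0.
apply: (lt_le_trans xr); rewrite /len /scale -invr_expz.
rewrite ler_pdivrMr ?exprz_gt0// mul1r.
have -> : 2 ^ I.1 = (2 ^+ `|I.1|)%:~R :> R.
  by rewrite -[in LHS](gez0_abs i0) rmorphXn.
by rewrite ler_int; lia.
Qed.

(** Membership of the left endpoint gives [0 <= I.2]. The midpoint lies in
    [[0, 1)] too: if the scale were negative it would be at least [1], and
    otherwise it forces [I.2 < 2^i]. *)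
Lemma subset_unit_dyadics I : interval_of I `<=` (`[0, 1[ : set R) ->
  exists n0, forall n, (n0 <= n)%N -> I \in unit_dyadics n.
Proof.
move=> sI; have l0 := len_gt0 (R:=R) I.
have inI (t : R) : 0 <= t < 1 -> 0 <= (I.2%:~R + t) * len I < 1.
  move=> /andP[t0 t1].
  have /sI : interval_of I ((I.2%:~R + t) * len I).
    rewrite /interval_of/= in_itv/= ler_pM2r// ltr_pM2r// lerDl t0.
    by rewrite intrD1 ltrD2l.
  by rewrite /= in_itv.
have k0 : 0 <= I.2.
  have /inI : 0 <= (0 : R) < 1 by rewrite lexx ltr01.
  by rewrite addr0 pmulr_lge0// ler0z => /andP[].
have /inI /andP[_] : 0 <= (2^-1 : R) < 1 by lra.
have kR : 0 <= I.2%:~R :> R by rewrite ler0z.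
have [i0|i0] := leP 0 I.1; last first.
  have : 2 <= len I :> R.
    rewrite /len -[leLHS]expr1z ler_weXz2l// ?ler1n// /scale; lia.
  by nra.
rewrite /len /scale -invr_expz ltr_pdivrMr ?exprz_gt0// mul1r.
have -> : 2 ^ I.1 = (2 ^+ `|I.1|)%:~R :> R.
  by rewrite -[in LHS](gez0_abs i0) rmorphXn.
move=> klt.
have {klt} k1 : I.2 < 2 ^+ `|I.1|.
  by rewrite -(ltr_int R); apply: lt_trans klt; rewrite ltrDl invr_gt0.
exists (`|I.1|).+1 => n nI; rewrite mem_unit_dyadics i0 k0 k1 /= andbT; lia.
Qed.

Lemma Lseq_unit (A : nat -> nat -> R) n I J :
  I \in unit_dyadics n -> J \in unit_dyadics n ->
  Lseq A I J = Num.sqrt (len I) * Num.sqrt (len J) * A `|I.1|%N `|J.1|%N.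
Proof.
move=> In Jn; rewrite /Lseq; case: asboolP => [_|]; last first.
  by case=> -[x y] /= [/(unit_dyadics_subset In) ? /(unit_dyadics_subset Jn) ?].
congr (_ * _); rewrite -sqrtrM ?(ltW (len_gt0 _))// -powR12_sqrt; last first.
  by rewrite mulr_ge0 ?(ltW (len_gt0 _)).
by rewrite powRrM -intrN powR_intmul// opprD expfzDr.
Qed.

Lemma Lseq_neq0 (A : nat -> nat -> R) I J : Lseq A I J != 0 ->
  exists n0, forall n, (n0 <= n)%N ->
    (I \in unit_dyadics n) && (J \in unit_dyadics n).
Proof.
rewrite /Lseq; case: asboolP => [sIJ _|]; last by rewrite eqxx.
have ne K : (interval_of K : set R) (K.2%:~R * len K).
  rewrite /interval_of /= in_itv /= lexx/= ltr_pM2r ?len_gt0//.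
  by rewrite ltr_int ltzD1.
have [n1 In] : exists n0, forall n, (n0 <= n)%N -> I \in unit_dyadics n.
  apply: subset_unit_dyadics => x Ix.
  by have [] := sIJ (x, _) (conj Ix (ne J)).
have [n2 Jn] : exists n0, forall n, (n0 <= n)%N -> J \in unit_dyadics n.
  apply: subset_unit_dyadics => x Jx.
  by have [] := sIJ (_, x) (conj (ne I) Jx).
exists (maxn n1 n2) => n; rewrite geq_max => /andP[n1n n2n].
by rewrite In// Jn.
Qed.

(** A sum with infinite support has the value [0] by convention, whence the
    first alternative; the families [unit_dyadics n] increase with [n], so one
    of them contains any given finite support. *)
Lemma fsum_unit_dyadics (F : dyadic * dyadic -> R) :
  (forall p, F p != 0 -> exists n0, forall n, (n0 <= n)%N ->
     (p.1 \in unit_dyadics n) && (p.2 \in unit_dyadics n)) ->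
  \sum_(p \in [set: dyadic * dyadic]) F p = 0 \/
  exists n, \sum_(p \in [set: dyadic * dyadic]) F p =
    \sum_(I <- unit_dyadics n) \sum_(J <- unit_dyadics n) F (I, J).
Proof.
move=> Fu; have [fF|] := pselect
  (finite_set ([set: dyadic * dyadic] `&` F @^-1` [set~ 0])); last first.
  by move=> iF; left; exact: fsbig_dflt.
right.
suff [n nF] : exists n, forall p, F p != 0 ->
    (p.1 \in unit_dyadics n) && (p.2 \in unit_dyadics n).
  by exists n; apply: fsum_square => //; exact: uniq_unit_dyadics.
pose S := fset_set ([set: dyadic * dyadic] `&` F @^-1` [set~ 0]).
have inS p : F p != 0 -> p \in (S : seq _).
  by move=> /eqP Fp; rewrite /= in_fset_set// inE; split.
have [n0 n0P] : {n0 : dyadic * dyadic -> nat & forall p, F p != 0 -> forall n,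
    (n0 p <= n)%N -> (p.1 \in unit_dyadics n) && (p.2 \in unit_dyadics n)}.
  apply: (@choice _ _ (fun p m => F p != 0 -> forall n, (m <= n)%N ->
     (p.1 \in unit_dyadics n) && (p.2 \in unit_dyadics n))) => p.
  have [_|/Fu [m mP]] := eqVneq (F p) 0; first by exists 0%N.
  by exists m.
exists (\max_(q <- S) n0 q)%N => p Fp; apply: n0P => //.
exact: leq_bigmax_seq (inS _ Fp) isT.
Qed.

End UnitDyadic.

(** * The bilinear form of a matrix *)

Section MatrixForm.
Context {R : realType}.
Implicit Types (A : nat -> nat -> R) (a b x y : nat -> R).

Lemma finite_support_bound a : finite_set [set i | a i != 0] ->
  exists n0, forall i, a i != 0 -> (i < n0)%N.
Proof.
move=> fa; pose S := fset_set [set i | a i != 0].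
exists (\max_(i <- S) i).+1 => i ai; rewrite ltnS.
have iS : i \in (S : seq _) by rewrite /= in_fset_set// inE.
exact: leq_bigmax_seq iS isT.
Qed.

Lemma fsum_sqr n a : (forall i, a i != 0 -> (i < n)%N) ->
  \sum_(i \in [set: nat]) a i ^+ 2 = \sum_(i < n) a i ^+ 2.
Proof.
move=> an; rewrite (fsbigE (iota 0 n)) ?iota_uniq//.
  by under eq_bigl do rewrite in_setT; rewrite big_iota_ord.
move=> i _; apply: contraNeq; rewrite sqrf_eq0 => /an.
by rewrite mem_iota.
Qed.

Lemma matrix_formE A n a b :
  (forall i, a i != 0 -> (i < n)%N) -> (forall i, b i != 0 -> (i < n)%N) ->
  matrix_form A a b = \sum_(i < n) \sum_(j < n) A i j * a i * b j.
Proof.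
move=> an bn; rewrite /matrix_form (@fsum_square _ _ (iota 0 n)) ?iota_uniq//.
  by rewrite big_iota_ord; apply: eq_bigr => i _; rewrite big_iota_ord.
move=> [i j]; rewrite !mulf_eq0 !negb_or !mem_iota /= !add0n.
by move=> /andP[/andP[_ /an ->] /bn ->].
Qed.

Lemma unit_finite_seqP n a : (forall i, a i != 0 -> (i < n)%N) ->
  \sum_(i < n) a i ^+ 2 = 1 -> unit_finite_seq a.
Proof.
move=> an a1; split; last by rewrite (fsum_sqr an) a1 sqrtr1.
by apply: (sub_finite_set _ (finite_II n)) => i /an.
Qed.

Lemma matrix_norm_ge0 A : (0 <= matrix_norm A)%E.
Proof.
pose e i : R := (i == 0%N)%:R.
have ue : unit_finite_seq e.
  apply: (@unit_finite_seqP 1) => [i|]; last by rewrite big_ord1 expr1n.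
  by rewrite /e; case: i => //= i; rewrite eqxx.
apply: (@le_trans _ _ (`|matrix_form A e e|%:E)); first by rewrite lee_fin.
by apply: ereal_sup_ubound; exists (e, e).
Qed.

(** Homogeneity extends the bound from unit sequences to all finite ones. The
    product of the norms is replaced by the mean of their squares, which can be
    summed over the cells of a grid without a further use of Cauchy-Schwarz. *)
Lemma matrix_norm_bound A (M : R) n x y : matrix_norm A = M%:E ->
  `|\sum_(i < n) \sum_(j < n) A i j * x i * y j| <=
    M * ((\sum_(i < n) x i ^+ 2 + \sum_(j < n) y j ^+ 2) / 2).
Proof.
move=> AM; have M0 : 0 <= M by rewrite -lee_fin -AM matrix_norm_ge0.
set X2 := \sum_(i < n) x i ^+ 2; set Y2 := \sum_(j < n) y j ^+ 2.
have sq0 (z : nat -> R) : 0 <= \sum_(i < n) z i ^+ 2.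
  by apply: sumr_ge0 => i _; exact: sqr_ge0.
have z0 (z : nat -> R) : \sum_(i < n) z i ^+ 2 = 0 -> forall i : 'I_n, z i = 0.
  move=> /eqP; rewrite psumr_eq0 => [/allP z0 i|i _]; last exact: sqr_ge0.
  by apply/eqP; have := z0 i; rewrite mem_index_enum sqrf_eq0 => /(_ isT).
have rhs0 : 0 <= M * ((X2 + Y2) / 2).
  by rewrite mulr_ge0// divr_ge0// addr_ge0// sq0.
have [/z0 X0|X0] := eqVneq X2 0.
  rewrite big1 ?normr0// => i _; rewrite big1// => j _.
  by rewrite X0 mulr0 mul0r.
have [/z0 Y0|Y0] := eqVneq Y2 0.
  rewrite big1 ?normr0// => i _; rewrite big1// => j _.
  by rewrite Y0 mulr0.
pose unit_of (z : nat -> R) i :=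
  if (i < n)%N then z i / Num.sqrt (\sum_(i < n) z i ^+ 2) else 0.
have supp (z : nat -> R) i : unit_of z i != 0 -> (i < n)%N.
  by rewrite /unit_of; case: ifP => //; rewrite eqxx.
have unit1 (z : nat -> R) : \sum_(i < n) z i ^+ 2 != 0 ->
    unit_finite_seq (unit_of z).
  move=> zn0; apply: unit_finite_seqP (supp z) _.
  under eq_bigr => i _ do
    rewrite /unit_of ltn_ord exprMn exprVn sqr_sqrtr ?sq0//.
  by rewrite -mulr_suml mulfV.
have : (`|matrix_form A (unit_of x) (unit_of y)|%:E <= matrix_norm A)%E.
  apply: ereal_sup_ubound; exists (unit_of x, unit_of y) => //.
  by split; exact: unit1.
rewrite AM lee_fin (matrix_formE A (supp x) (supp y)).
have -> : \sum_(i < n) \sum_(j < n) A i j * unit_of x i * unit_of y j =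
    (\sum_(i < n) \sum_(j < n) A i j * x i * y j) / (Num.sqrt X2 * Num.sqrt Y2).
  rewrite mulr_suml; apply: eq_bigr => i _; rewrite mulr_suml.
  apply: eq_bigr => j _; rewrite /unit_of !ltn_ord invfM -/X2 -/Y2; ring.
have sX : 0 < Num.sqrt X2 by rewrite sqrtr_gt0 lt_neqAle eq_sym X0 sq0.
have sY : 0 < Num.sqrt Y2 by rewrite sqrtr_gt0 lt_neqAle eq_sym Y0 sq0.
rewrite normrM normfV (ger0_norm (ltW (mulr_gt0 sX sY))).
rewrite ler_pdivrMr ?mulr_gt0//.
move=> /le_trans; apply; rewrite ler_wpM2l//.
rewrite -[X in X + _](sqr_sqrtr (sq0 x)) -[X in _ + X](sqr_sqrtr (sq0 y)).
rewrite -/X2 -/Y2; have := sqr_ge0 (Num.sqrt X2 - Num.sqrt Y2); nra.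
Qed.

End MatrixForm.

(** * The paraproduct is bounded by the matrix norm *)

Section Blocks.
Context {R : realType}.

Lemma sum_pick n p (F : nat -> R) : (p < n)%N ->
  \sum_(l < n) (p == l)%:R * F l = F p.
Proof.
move=> pn; rewrite (bigD1 (Ordinal pn))//= eqxx mul1r big1 ?addr0// => l lp.
have /negPf -> : p != l by apply: contraNneq lp => pl; apply/eqP/val_inj.
by rewrite mul0r.
Qed.

Lemma sum_blocks a b (G : nat -> R) :
  \sum_(k < a * b) G (k %/ b)%N = b%:R * \sum_(l < a) G l.
Proof.
elim: a => [|a IHa]; first by rewrite mul0n !big_ord0 mulr0.
rewrite mulSnr big_split_ord/= IHa big_ord_recr/= mulrDr; congr (_ + _).
case: b {IHa} => [|b]; first by rewrite big_ord0 mul0r.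
under eq_bigr => k _ do rewrite divnMDl// divn_small// addn0.
by rewrite sumr_const card_ord mulr_natl.
Qed.

(** Discrete form of exchanging [sum_(I, J) int_J F_I int_I G_J] for the
    integral over [(x, y)] of [F_(I(x))(y) G_(J(y))(x)]: each pair of points
    [(k, k')] lies over exactly one pair of intervals [(l, m)], with
    [p k' = l] and [q k = m]. *)
Lemma sum_fibres K L M (p q : nat -> nat) (a b : nat -> nat -> R) :
  (forall k, (k < K)%N -> (p k < L)%N) ->
  (forall k, (k < K)%N -> (q k < M)%N) ->
  \sum_(l < L) \sum_(m < M) (\sum_(k < K) (q k == m)%:R * a l k) *
                            (\sum_(k < K) (p k == l)%:R * b k m) =
  \sum_(k < K) \sum_(k' < K) a (p k') k * b k' (q k).
Proof.
move=> pL qM.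
under eq_bigr => l _ do under eq_bigr => m _ do
  (rewrite mulr_suml; under eq_bigr => k _ do rewrite mulr_sumr).
under eq_bigr => l _ do rewrite exchange_big/=.
rewrite exchange_big/=; apply: eq_bigr => k _.
under eq_bigr => l _ do rewrite exchange_big/=.
rewrite exchange_big/=; apply: eq_bigr => k' _.
transitivity (\sum_(l < L) (p k' == l)%:R * (a l k * b k' (q k))).
  apply: eq_bigr => l _.
  rewrite -[in RHS](sum_pick (fun m => b k' m) (qM k (ltn_ord k))) !mulr_sumr.
  by apply: eq_bigr => m _; ring.
exact: (sum_pick (fun l => a l k * b k' (q k)) (pL k' (ltn_ord k'))).
Qed.

End Blocks.

Section UpperBound.
Context {R : realType}.

Local Notation leb := (@lebesgue_measure R).
Local Notation L2xy := (Lfun (lebesgue2 R) 2%:E).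
Local Notation parent n i k := (k %/ 2 ^ (n - i))%N.

Lemma parent_lt n i k : (i <= n)%N -> (k < 2 ^ n)%N -> (parent n i k < 2 ^ i)%N.
Proof. by move=> i_n kn; rewrite ltn_divLR ?expn_gt0// -expnD subnKC. Qed.

(** The cells of scale [n] inside the interval [m] of scale [j] are those whose
    parent is [m]; [2^j / 2^n] is the proportion that each of them takes. *)
Lemma avg_refine (n j m : nat) x : (j <= n)%N -> (m < 2 ^ j)%N ->
  avg (j%:Z, m%:Z) x =
  \sum_(k < (2 ^ n)%N) (parent n j k == m)%:R *
    (2 ^+ j / 2 ^+ n * avg (n%:Z, k%:Z) x) :> R.
Proof.
move=> jn mj; rewrite /avg /len /scale /= -!invr_expz !invrK -!exprnP.
rewrite indic_interval /= (cell_coarsen j%:Z (n - j)%N) -PoszD subnKC//.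
set c := cell _ _.
have p0 : (0 < 2 ^ (n - j))%N by rewrite expn_gt0.
rewrite -PoszX2; have [[c0 cn]|nc] := pselect (0 <= c /\ c < (2 ^ n)%N%:Z).
  (* [x] is in [[0, 1)], and only its own cell contributes. *)
  have [k kc] : exists k, c = k%:Z by exists `|c|%N; rewrite gez0_abs.
  move: cn; rewrite kc ltz_nat => kn; rewrite divz_nat eqz_nat.
  rewrite (bigD1 (Ordinal kn))//= [X in _ + X]big1 ?addr0; last first.
    move=> k' k'k; rewrite indic_interval /= -/c kc eqz_nat.
    have /negPf -> : k != k'.
      by apply: contraNneq k'k => E; apply/eqP/val_inj.
    by rewrite mul0r !mulr0.
  rewrite indic_interval /= -/c kc eqxx mul1r mulfVK// expf_neq0//.
(* [x] is outside [[0, 1)], hence outside every interval involved. *)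
have /negPf -> : (c %/ (2 ^ (n - j))%N%:Z)%Z != m%:Z.
  apply: contra_not_neq nc => cm.
  have mp : ((m.+1 * 2 ^ (n - j))%N <= (2 ^ n)%N)%N.
    by rewrite -[X in (_ <= 2 ^ X)%N](subnKC jn) expnD leq_mul2r mj orbT.
  have := divz_eq c (2 ^ (n - j))%N%:Z; rewrite cm.
  have r0 := @modz_ge0 c (2 ^ (n - j))%N%:Z.
  have rp := @ltz_pmod c (2 ^ (n - j))%N%:Z.
  by move: p0 mp r0 rp; move: (2 ^ (n - j))%N => p; nia.
rewrite mul0r big1// => k _; rewrite indic_interval /= -/c.
have /negPf -> : c != k%:Z.
  by apply: contra_not_neq nc => ->; split=> //; rewrite ltz_nat.
by rewrite mul0r !mulr0.
Qed.

Definition cell_normalized (n k : nat) (x : R) : R :=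
  Num.sqrt (len (n%:Z, k%:Z)) * avg (n%:Z, k%:Z) x.

Lemma orthonormal_cells n : orthonormal_system leb (cell_normalized n).
Proof.
split=> [k|k k']; first exact/L2Z/avg_L2.
have avgE (I : dyadic) :
    avg I = (fun x => (len I)^-1 * \1_(interval_of I) x) :> (R -> R).
  by apply/funext => x; rewrite /avg mulrC.
rewrite dotZl ?dotZr ?avg_L2//; last exact/L2Z/avg_L2.
rewrite !avgE dotZl ?dotZr ?interval_L2//; last exact/L2Z/interval_L2.
rewrite dot_interval//= -pair_eqE /pair_eq/= eqxx/= eqz_nat.
have l0 := len_gt0 (R:=R) (n%:Z, k%:Z).
have -> : len (n%:Z, k'%:Z) = len (n%:Z, k%:Z) :> R by [].
rewrite mulrA -expr2 sqr_sqrt_len; field.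
by rewrite gt_eqF.
Qed.

(** The factor [|I|^(1/2)] comes from [Lseq], and [2^i / 2^n] is the proportion
    of [I] taken by a cell of scale [n]. *)
Definition scale_weight (n i : nat) : R :=
  Num.sqrt (len (i%:Z, 0)) * (2 ^+ i / 2 ^+ n).

Lemma scale_weight_sqr n i : (i <= n)%N ->
  scale_weight n i ^+ 2 * (2 ^ (n - i))%N%:R = (2 ^+ n)^-1.
Proof.
move=> i_n; rewrite /scale_weight exprMn sqr_sqrt_len natrX.
rewrite /len /scale /= -!exprnN.
have := subnKC i_n; move: (n - i)%N => m <-; rewrite exprD.
by field; rewrite !expf_neq0.
Qed.

(** The discrete [int int |a|^2 <= |f|^2]. For fixed [k] and [i], each interval
    of scale [i] is the parent of [2^(n-i)] cells [k'], and this multiplicity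
    turns the squared weight into [2^-n = |K|], the normalisation for which
    Bessel's inequality applies. *)
Lemma block_energy n (f : R * R -> R) (e : dyadic * nat -> R * R -> R)
    (c : dyadic -> nat -> R) :
  f \in L2xy -> orthonormal_system (lebesgue2 R) e ->
  (forall I k, inner f (e (I, k)) = Num.sqrt (len (n%:Z, k%:Z)) * c I k) ->
  \sum_(k < (2 ^ n)%N) \sum_(k' < (2 ^ n)%N) \sum_(i < n)
    (scale_weight n i * c (i%:Z, (parent n i k')%:Z) k) ^+ 2 <= inner f f.
Proof.
move=> f2 oe ec.
pose s := [seq (J, k) | J <- unit_dyadics n, k <- iota 0 (2 ^ n)%N].
have us : uniq s.
  apply: allpairs_uniq; [exact: uniq_unit_dyadics|exact: iota_uniq|].
  by move=> [? ?] [? ?] _ _ [-> ->].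
have := bessel oe us f2; congr (_ <= _).
rewrite big_allpairs_dep exchange_big /= big_iota_ord; apply: eq_bigr => k _.
rewrite big_unit_dyadics [RHS]exchange_big /=; apply: eq_bigr => i _.
have i_n : (i <= n)%N by exact: ltnW.
under [RHS]eq_bigr do rewrite exprMn.
rewrite -mulr_sumr.
have -> : \sum_(k' < (2 ^ n)%N) c (i%:Z, (parent n i k')%:Z) k ^+ 2 =
   (2 ^ (n - i))%N%:R * \sum_(l < (2 ^ i)%N) c (i%:Z, l%:Z) k ^+ 2.
  rewrite -(sum_blocks (2 ^ i) (2 ^ (n - i)) (fun l => c (i%:Z, l%:Z) k ^+ 2)).
  by rewrite -expnD subnKC.
rewrite mulrA scale_weight_sqr// mulr_sumr; apply: eq_bigr => l _.
rewrite -[dot _ _ _]/(inner f (e _)) ec exprMn sqr_sqrt_len; congr (_ * _).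
by rewrite /len /scale/= exprnN.
Qed.

Lemma paraproduct_le A (M : R) f g :
  f \in L2xy -> g \in L2xy -> inner f f = 1 -> inner g g = 1 ->
  matrix_norm A = M%:E -> `|paraproduct (Lseq A) f g| <= M.
Proof.
move=> f2 g2 f1 g1 AM; have M0 : 0 <= M by rewrite -lee_fin -AM matrix_norm_ge0.
rewrite /paraproduct; set F := (fun p : dyadic * dyadic => _ * _ * _).
have Fu p : F p != 0 -> exists n0, forall n, (n0 <= n)%N ->
    (p.1 \in unit_dyadics n) && (p.2 \in unit_dyadics n).
  by rewrite !mulf_eq0 !negb_or => /andP[/andP[/Lseq_neq0]].
(* An infinitely supported sum is [0]; otherwise all scales are below [n]. *)
have [->|[n ->]] := fsum_unit_dyadics Fu; first by rewrite normr0.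
pose c I k := inner f (tensor (haar I) (avg (n%:Z, k%:Z))).
pose c' J k := inner g (tensor (avg (n%:Z, k%:Z)) (haar J)).
have fE I j m : (j <= n)%N -> (m < 2 ^ j)%N ->
    inner f (tensor (haar I) (avg (j%:Z, m%:Z))) =
    \sum_(k < (2 ^ n)%N) (parent n j k == m)%:R * (2 ^+ j / 2 ^+ n * c I k).
  move=> jn mj; under eq_bigr do rewrite mulrA.
  rewrite -dot_lincomb// => [|k]; last exact/L2_tensor/avg_L2/haar_L2.
  congr inner; apply/funext => z.
  rewrite /tensor (avg_refine _ jn mj) mulr_sumr.
  by apply: eq_bigr => k _; ring.
have gE J j m : (j <= n)%N -> (m < 2 ^ j)%N ->
    inner g (tensor (avg (j%:Z, m%:Z)) (haar J)) =
    \sum_(k < (2 ^ n)%N) (parent n j k == m)%:R * (2 ^+ j / 2 ^+ n * c' J k).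
  move=> jn mj; under eq_bigr do rewrite mulrA.
  rewrite -dot_lincomb// => [|k]; last exact/L2_tensor/haar_L2/avg_L2.
  congr inner; apply/funext => z.
  rewrite /tensor (avg_refine _ jn mj) mulr_suml.
  by apply: eq_bigr => k _; ring.
(* The vectors to which the form of [A] is applied at the cells [k], [k']. *)
pose x k k' i := scale_weight n i * c (i%:Z, (parent n i k')%:Z) k.
pose y k k' j := scale_weight n j * c' (j%:Z, (parent n j k)%:Z) k'.
have -> : \sum_(I <- unit_dyadics n) \sum_(J <- unit_dyadics n) F (I, J) =
  \sum_(k < (2 ^ n)%N) \sum_(k' < (2 ^ n)%N)
    \sum_(i < n) \sum_(j < n) A i j * x k k' i * y k k' j.
  rewrite big_unit_dyadics.
  (* Group the terms by scales, and refine both averages to scale [n]. *)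
  transitivity (\sum_(i < n) \sum_(j < n)
      Num.sqrt (len (i%:Z, 0)) * Num.sqrt (len (j%:Z, 0)) * A i j *
    \sum_(l < (2 ^ i)%N) \sum_(m < (2 ^ j)%N)
      (\sum_(k < (2 ^ n)%N) (parent n j k == m)%:R *
         (2 ^+ j / 2 ^+ n * c (i%:Z, l%:Z) k)) *
      (\sum_(k' < (2 ^ n)%N) (parent n i k' == l)%:R *
         (2 ^+ i / 2 ^+ n * c' (j%:Z, m%:Z) k'))).
    apply: eq_bigr => i _; under eq_bigr do rewrite big_unit_dyadics.
    rewrite exchange_big /=; apply: eq_bigr => j _.
    rewrite mulr_sumr; apply: eq_bigr => l _.
    rewrite mulr_sumr; apply: eq_bigr => m _.
    have in_unit (p q : nat) : (p < n)%N -> (q < 2 ^ p)%N ->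
        (p%:Z, q%:Z) \in unit_dyadics n.
      by move=> pn qp; rewrite mem_unit_dyadics/= -PoszX2 !ltz_nat pn.
    rewrite /F/= (@Lseq_unit _ A n) ?in_unit//=.
    rewrite (fE _ _ _ (ltnW (ltn_ord j)))// (gE _ _ _ (ltnW (ltn_ord i)))//.
    by rewrite -!mulrA.
  under eq_bigr => i _ do under eq_bigr => j _ do
    rewrite (@sum_fibres _ _ _ _ (fun k => parent n i k) (fun k => parent n j k)
      (fun l k => 2 ^+ j / 2 ^+ n * c (i%:Z, l%:Z) k)
      (fun k' m => 2 ^+ i / 2 ^+ n * c' (j%:Z, m%:Z) k')
      (fun k => parent_lt (ltnW (ltn_ord i)))
      (fun k => parent_lt (ltnW (ltn_ord j)))) mulr_sumr.
  under eq_bigr => i _ do (rewrite exchange_big; under eq_bigr => k _ do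
    (under eq_bigr => j _ do rewrite mulr_sumr; rewrite exchange_big)).
  rewrite exchange_big; apply: eq_bigr => k _.
  rewrite exchange_big; apply: eq_bigr => k' _.
  apply: eq_bigr => i _; apply: eq_bigr => j _.
  rewrite /x /y /scale_weight; ring.
have Ex : \sum_(k < (2 ^ n)%N) \sum_(k' < (2 ^ n)%N)
    \sum_(i < n) x k k' i ^+ 2 <= 1.
  rewrite -f1; apply: (block_energy f2
    (orthonormal_tensor haar_orthonormal (orthonormal_cells n))).
  move=> I k; rewrite -dotZr//; last exact/L2_tensor/avg_L2/haar_L2.
  congr inner; apply/funext => z; rewrite /tensor /cell_normalized/=; ring.
have Ey : \sum_(k < (2 ^ n)%N) \sum_(k' < (2 ^ n)%N)
    \sum_(j < n) y k k' j ^+ 2 <= 1.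
  rewrite exchange_big -g1.
  have swap_inj : injective (fun p : dyadic * nat => (p.2, p.1)).
    by move=> [? ?] [? ?] [-> ->].
  apply: (block_energy g2 (orthonormal_reindex swap_inj
    (orthonormal_tensor (orthonormal_cells n) haar_orthonormal))).
  move=> J k; rewrite -dotZr//; last exact/L2_tensor/haar_L2/avg_L2.
  congr inner; apply/funext => z; rewrite /tensor /cell_normalized/=; ring.
(* Bound the form of [A] separately at each pair of cells. *)
apply: (le_trans (ler_norm_sum _ _ _)).
apply: (@le_trans _ _ (\sum_(k < (2 ^ n)%N) \sum_(k' < (2 ^ n)%N)
   M * ((\sum_(i < n) x k k' i ^+ 2 + \sum_(j < n) y k k' j ^+ 2) / 2))).
  apply: ler_sum => k _; apply: (le_trans (ler_norm_sum _ _ _)).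
  by apply: ler_sum => k' _; exact: matrix_norm_bound.
under eq_bigr do (rewrite -mulr_sumr -mulr_suml big_split/=).
rewrite -mulr_sumr -mulr_suml big_split/=; nra.
Qed.

End UpperBound.

(** * Haar series of tensor products *)

Section HaarExpansion.
Context {R : realType}.

Local Notation leb := (@lebesgue_measure R).
Local Notation L2 := (Lfun leb 2%:E).
Local Notation L2xy := (Lfun (lebesgue2 R) 2%:E).

Lemma ler_sum_subset (T : eqType) (s t : seq T) (F : T -> R) :
  uniq s -> uniq t -> {subset s <= t} -> (forall x, 0 <= F x) ->
  \sum_(x <- s) F x <= \sum_(x <- t) F x.
Proof.
move=> us ut st F0.
have sE : perm_eq s [seq x <- t | x \in s].
  apply: uniq_perm => //; first exact: filter_uniq.
  by move=> x; rewrite mem_filter; case: (boolP (x \in s)) => //= /st ->.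
rewrite (perm_big _ sE) big_filter big_mkcond /=.
by apply: ler_sum => x _; case: ifP.
Qed.

(** Parseval's identity for [u], as an approximation property: finitely many
    Haar coefficients carry almost all of the energy of [u]. *)
Definition haar_exhausts (u : R -> R) := forall eps : R, 0 < eps ->
  exists2 s, uniq s &
    dot leb u u - eps <= \sum_(I <- s) dot leb u (haar I) ^+ 2.

(** By [dot_residual] the error of a partial sum is the missing energy, which
    decreases when terms are added; one good finite set of indices is enough for
    convergence along all larger ones. *)
Lemma haar_sum_parseval (f : R * R -> R) : f \in L2xy ->
  (forall eps : R, 0 < eps -> exists2 s, uniq s & inner f f - eps <=
    \sum_(p <- s) inner f (tensor (haar p.1) (haar p.2)) ^+ 2) ->
  haar_sum (fun I J => inner f (tensor (haar I) (haar J))) f.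
Proof.
move=> f2 fs; rewrite /haar_sum.
have oe := orthonormal_tensor (@haar_orthonormal R) (@haar_orthonormal R).
pose r (S : {fset dyadic * dyadic}) :=
  inner f f - \sum_(p <- S) inner f (tensor (haar p.1) (haar p.2)) ^+ 2.
rewrite [X in X @ _ --> _](_ : _ = (fun S => (Num.sqrt (r S))%:E)); last first.
  apply/funext => S.
  have [h2 hh] := dot_residual oe (fset_uniq S) f2.
  by rewrite /L2norm Lnorm2E// hh.
have totallyF := @filter_filter _ _ (@totally_filter (dyadic * dyadic)%type).
apply: cvg_EFin; first exact: nearW.
apply/cvgrPdist_le => eps eps0.
have [s us sP] := fs _ (exprn_gt0 2 eps0).
exists [fset p in s]%fset => // S /fsubsetP sS /=.
rewrite sub0r normrN ger0_norm ?sqrtr_ge0//.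
rewrite -[leRHS]ger0_norm ?(ltW eps0)// -sqrtr_sqr ler_wsqrtr//.
rewrite /r lerBlDr -lerBlDl; apply: (le_trans sP).
apply: ler_sum_subset => //; first exact: fset_uniq; last first.
  by move=> p; exact: sqr_ge0.
by move=> p ps; apply: sS; rewrite inE.
Qed.

(** The coefficients factor, so the captured energy is a product [S * T] of
    numbers in [[0, 1]] and [1 - S * T <= (1 - S) + (1 - T)]. *)
Lemma haar_sum_tensor (u v : R -> R) : u \in L2 -> v \in L2 ->
  dot leb u u = 1 -> dot leb v v = 1 -> haar_exhausts u -> haar_exhausts v ->
  haar_sum (fun I J => inner (tensor u v) (tensor (haar I) (haar J)))
    (tensor u v).
Proof.
move=> u2 v2 u1 v1 uh vh; apply: haar_sum_parseval; first exact: L2_tensor.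
move=> eps eps0; have eps2 : 0 < eps / 2 by rewrite divr_gt0.
have [s us sP] := uh _ eps2; have [t ut tP] := vh _ eps2.
exists [seq (x, y) | x <- s, y <- t].
  by apply: allpairs_uniq => // -[? ?] [? ?] _ _ [-> ->].
rewrite big_allpairs_dep dot_tensor// u1 v1.
have -> : \sum_(x <- s) \sum_(y <- t)
    inner (tensor u v) (tensor (haar x) (haar y)) ^+ 2 =
  (\sum_(x <- s) dot leb u (haar x) ^+ 2) *
  (\sum_(y <- t) dot leb v (haar y) ^+ 2).
  rewrite mulr_suml; apply: eq_bigr => x _; rewrite mulr_sumr.
  by apply: eq_bigr => y _; rewrite dot_tensor ?haar_L2// exprMn.
have := bessel (@haar_orthonormal R) us u2.
have := bessel (@haar_orthonormal R) ut v2.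
move: sP tP; rewrite u1 v1.
have : 0 <= \sum_(x <- s) dot leb u (haar x) ^+ 2.
  by apply: sumr_ge0 => x _; exact: sqr_ge0.
have : 0 <= \sum_(x <- t) dot leb v (haar x) ^+ 2.
  by apply: sumr_ge0 => x _; exact: sqr_ge0.
by move: (\sum_(x <- s) _) (\sum_(x <- t) _) => S T; nra.
Qed.

End HaarExpansion.

(** * Extremal test functions *)

Section TestFunctions.
Context {R : realType}.

Local Notation leb := (@lebesgue_measure R).
Local Notation L2 := (Lfun leb 2%:E).

Definition unit_indic : R -> R := \1_(interval_of (0, 0)).

Lemma unit_indic_L2 : unit_indic \in L2.
Proof. exact: interval_L2. Qed.

Lemma unit_indic_norm : dot leb unit_indic unit_indic = 1.
Proof. by rewrite dot_interval// eqxx mul1r /len expr0z. Qed.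

Lemma unit_indic_avg n J : J \in unit_dyadics n ->
  dot leb unit_indic (avg J) = 1.
Proof.
move=> /(@unit_dyadics_subset R) sJ.
have E x : unit_indic x * avg J x = (len J)^-1 * \1_(interval_of J) x.
  rewrite /avg [RHS]mulrC mulrA; congr (_ / _); rewrite /unit_indic !indicE.
  case: (boolP (x \in interval_of J)) => xJ; last by rewrite mulr0.
  suff -> : x \in interval_of (0, 0) by rewrite mulr1.
  have := sJ x (set_mem xJ); rewrite /= in_itv/= => x01.
  apply/mem_set; rewrite /interval_of/= in_itv/= /len /scale/=.
  by rewrite oppr0 expr0z mul0r mulr1.
rewrite /dot; under eq_Rintegral do rewrite E.
rewrite RintegralZl//; last exact: integrable_interval.
by rewrite Rintegral_interval mulVf// gt_eqF// len_gt0.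
Qed.

(** [[0, 1)] lies in the left half of [[0, 2^(k+1))], so that the Haar function
    of the latter is constant on it. *)
Lemma unit_indic_haar (k : nat) :
  dot leb unit_indic (haar (- (k.+1)%:Z, 0)) ^+ 2 = 2^-1 ^+ k.+1.
Proof.
have E x : unit_indic x * haar (- (k.+1)%:Z, 0) x =
   (Num.sqrt (len (- (k.+1)%:Z, 0)))^-1 * \1_(interval_of (0, 0)) x.
  rewrite haarE /unit_indic indic_interval /= mul0rn add0r.
  have := cell_coarsen (- (k.+1)%:Z + 1) k x.
  have -> : - (k.+1)%:Z + 1 + k%:Z = 0 by lia.
  move=> ->; case: eqVneq => [->|_]; last by rewrite mul0r mulr0.
  by rewrite div0z mul1r mulr1 subr0 mulr1.
rewrite /dot; under eq_Rintegral do rewrite E.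
rewrite RintegralZl//; last exact: integrable_interval.
rewrite Rintegral_interval exprMn !exprVn sqr_sqrt_len /len /scale /=.
by rewrite oppr0 expr0z expr1n mulr1 opprK.
Qed.

(** The intervals [[0, 2^k)] with [1 <= k <= K] capture the energy
    [2^-1 + ... + 2^-K = 1 - 2^-K]. *)
Lemma unit_indic_exhausts : haar_exhausts unit_indic.
Proof.
move=> eps eps0; pose K := Num.bound eps^-1.
exists [seq (- (k.+1)%:Z, 0) : dyadic | k <- iota 0 K].
  by rewrite map_inj_uniq ?iota_uniq// => i j [] /eqP; lia.
rewrite big_map big_iota_ord unit_indic_norm.
under eq_bigr do rewrite unit_indic_haar.
have -> : \sum_(k < K) 2^-1 ^+ k.+1 = 1 - 2^-1 ^+ K :> R.
  elim: K => [|K IHK]; first by rewrite big_ord0 expr0 subrr.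
  by rewrite big_ord_recr/= IHK exprS; field.
rewrite lerB// exprVn invf_ple ?posrE ?exprn_gt0//.
apply: ltW; apply: (lt_le_trans (archi_boundP (ltW _))).
  by rewrite invr_gt0.
by rewrite -natrX ler_nat ltnW// ltn_expl.
Qed.

(** For fixed [i], the sum of [|I|^(1/2) h_I] over the subintervals of [[0, 1)]
    of scale [i] takes the values [1] and [-1] on the left and right halves: it
    is the [i]-th Rademacher function. *)
Definition rademacher_sum (n : nat) (a : nat -> R) (x : R) : R :=
  \sum_(I <- unit_dyadics n) (a `|I.1|%N * Num.sqrt (len I)) * haar I x.

Lemma rademacher_L2 n (a : nat -> R) : rademacher_sum n a \in L2.
Proof. exact: L2_orthonormal_sum haar_orthonormal. Qed.

Lemma rademacher_haar n (a : nat -> R) I :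
  dot leb (rademacher_sum n a) (haar I) =
  if I \in unit_dyadics n then a `|I.1|%N * Num.sqrt (len I) else 0.
Proof.
exact: (dot_orthonormal_sum (fun I : dyadic => a `|I.1|%N * Num.sqrt (len I))
  I haar_orthonormal (uniq_unit_dyadics n)).
Qed.

Lemma sum_len_scale (i : nat) : \sum_(l < (2 ^ i)%N) len (i%:Z, l%:Z) = 1 :> R.
Proof.
rewrite /len /scale /= sumr_const card_ord -[LHS]mulr_natl natrX -exprnN.
by rewrite divff// expf_neq0.
Qed.

Lemma rademacher_energy n (a : nat -> R) :
  \sum_(I <- unit_dyadics n) (a `|I.1|%N * Num.sqrt (len I)) ^+ 2 =
  \sum_(i < n) a i ^+ 2.
Proof.
rewrite big_unit_dyadics; apply: eq_bigr => i _.
under eq_bigr do rewrite exprMn sqr_sqrt_len /=.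
by rewrite -mulr_sumr sum_len_scale mulr1.
Qed.

Lemma rademacher_norm n (a : nat -> R) :
  dot leb (rademacher_sum n a) (rademacher_sum n a) = \sum_(i < n) a i ^+ 2.
Proof.
rewrite -rademacher_energy.
exact: (dot_orthonormal_sum_self _ haar_orthonormal (uniq_unit_dyadics n)).
Qed.

Lemma rademacher_exhausts n (a : nat -> R) : haar_exhausts (rademacher_sum n a).
Proof.
move=> eps eps0; exists (unit_dyadics n); first exact: uniq_unit_dyadics.
rewrite rademacher_norm -rademacher_energy.
rewrite [X in _ <= X]big_seq; under [X in _ <= X]eq_bigr => I In do
  rewrite rademacher_haar In.
by rewrite -big_seq gerBl ltW.
Qed.

Lemma rademacher_testA n (a : nat -> R) : \sum_(i < n) a i ^+ 2 = 1 ->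
  testA (tensor (rademacher_sum n a) unit_indic).
Proof.
move=> a1; have r2 := rademacher_L2 n a; have o2 := unit_indic_L2.
have f2 := L2_tensor r2 o2; split=> //.
  rewrite /L2norm Lnorm2E// -[dot _ _ _]/(inner _ _) dot_tensor//.
  by rewrite rademacher_norm a1 unit_indic_norm mulr1 sqrtr1.
eexists.
  apply: haar_sum_tensor => //;
    rewrite ?unit_indic_norm ?rademacher_norm//.
  - exact: rademacher_exhausts.
  - exact: unit_indic_exhausts.
apply: (sub_finite_set _ (finite_seq (unit_dyadics n))) => I [J] /=.
rewrite dot_tensor ?haar_L2// rademacher_haar.
by case: ifP => //; rewrite mul0r eqxx.
Qed.

Lemma rademacher_testB n (a : nat -> R) : \sum_(i < n) a i ^+ 2 = 1 ->
  testB (tensor unit_indic (rademacher_sum n a)).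
Proof.
move=> a1; have r2 := rademacher_L2 n a; have o2 := unit_indic_L2.
have f2 := L2_tensor o2 r2; split=> //.
  rewrite /L2norm Lnorm2E// -[dot _ _ _]/(inner _ _) dot_tensor//.
  by rewrite rademacher_norm a1 unit_indic_norm mulr1 sqrtr1.
eexists.
  apply: haar_sum_tensor => //;
    rewrite ?unit_indic_norm ?rademacher_norm//.
  - exact: unit_indic_exhausts.
  - exact: rademacher_exhausts.
apply: (sub_finite_set _ (finite_seq (unit_dyadics n))) => J [I] /=.
rewrite dot_tensor ?haar_L2// rademacher_haar.
by case: ifP => //; rewrite mulr0 eqxx.
Qed.

(** Each term is [A^ij a_i b_j |I| |J|]: [Lseq], the coefficient of [r_a] and
    that of [r_b] contribute [(|I| |J|)^(1/2)], [|I|^(1/2)] and [|J|^(1/2)].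
    Summing over all [I] and [J] of given scales gives [A^ij a_i b_j]. *)
Lemma paraproduct_rademacher A n (a b : nat -> R) :
  paraproduct (Lseq A) (tensor (rademacher_sum n a) unit_indic)
                       (tensor unit_indic (rademacher_sum n b)) =
  \sum_(i < n) \sum_(j < n) A i j * a i * b j.
Proof.
have r2 c := rademacher_L2 n c; have o2 := unit_indic_L2.
rewrite /paraproduct (@fsum_square _ _ (unit_dyadics n)); last 2 first.
- exact: uniq_unit_dyadics.
- move=> [I J] /=; rewrite !dot_tensor ?haar_L2 ?avg_L2// !rademacher_haar.
  by case: ifP; case: ifP; rewrite ?(mulr0, mul0r) ?eqxx.
rewrite [LHS]big_seq.
under eq_bigr => I In.
  rewrite big_seq; under eq_bigr => J Jn.
    rewrite /= !dot_tensor ?haar_L2 ?avg_L2// !rademacher_haar In Jn.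
    rewrite (unit_indic_avg In) (unit_indic_avg Jn) (Lseq_unit A In Jn).
    over.
  rewrite -big_seq.
  over.
rewrite -big_seq big_unit_dyadics; apply: eq_bigr => i _.
under eq_bigr do rewrite big_unit_dyadics.
rewrite exchange_big; apply: eq_bigr => j _ /=.
transitivity (\sum_(l < (2 ^ i)%N) \sum_(m < (2 ^ j)%N)
   (A i j * a i * b j) * (len (i%:Z, l%:Z) * len (j%:Z, m%:Z)) : R).
  apply: eq_bigr => l _; apply: eq_bigr => m _.
  rewrite -[in RHS](sqr_sqrt_len (i%:Z, l%:Z)).
  by rewrite -[in RHS](sqr_sqrt_len (j%:Z, m%:Z)) /=; ring.
under eq_bigr do rewrite -mulr_sumr -mulr_sumr sum_len_scale mulr1.
by rewrite -mulr_sumr sum_len_scale mulr1.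
Qed.

End TestFunctions.

(** * Equality of the two norms *)

Theorem theorem1p1 (R : realType) (A : nat -> nat -> R) :
  (matrix_bounded A <-> paraproduct_bounded (Lseq A)) /\
  matrix_norm A = paraproduct_norm (Lseq A).
Proof.
suff E : matrix_norm A = paraproduct_norm (Lseq A).
  by rewrite /matrix_bounded /paraproduct_bounded E.
apply/eqP; rewrite eq_le; apply/andP; split.
- apply: ge_ereal_sup => _ [[a b] /= [[fa a1] [fb b1]] <-].
  have [na an] := finite_support_bound fa.
  have [nb bn] := finite_support_bound fb.
  pose n := maxn na nb.
  have {}an i : a i != 0 -> (i < n)%N by move=> /an; rewrite leq_max => ->.
  have {}bn i : b i != 0 -> (i < n)%N by move=> /bn; rewrite leq_max orbC => ->.
  have sqrt1 (x : R) : Num.sqrt x = 1 -> x = 1.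
    move=> x1; have := sqr_sqrtr (_ : 0 <= x); rewrite x1 expr1n => -> //.
    rewrite leNgt; apply/negP => /ltW /ler0_sqrtr; rewrite x1 => /eqP.
    by rewrite oner_eq0.
  apply: ereal_sup_ubound.
  exists (tensor (rademacher_sum n a) unit_indic,
          tensor unit_indic (rademacher_sum n b)).
    by split; [apply: rademacher_testA|apply: rademacher_testB];
      rewrite -fsum_sqr//; exact: sqrt1.
  by rewrite /= paraproduct_rademacher (matrix_formE A an bn).
- apply: ge_ereal_sup => _ [[f g] /= [[f2 f1 _] [g2 g1 _]] <-].
  have norm1 (h : R * R -> R) : h \in Lfun (lebesgue2 R) 2%:E ->
      L2norm h = 1%E -> inner h h = 1.
    move=> h2; rewrite /L2norm Lnorm2E// => -[h1].
    by rewrite -[LHS](sqr_sqrtr (dot_ge0 (lebesgue2 R) h)) h1 expr1n.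
  case AM : (matrix_norm A) => [M| |]; last 2 first.
  - by rewrite leey.
  - by have := matrix_norm_ge0 A; rewrite AM.
  by rewrite lee_fin; apply: paraproduct_le => //; exact: norm1.
Qed.
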